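(* There is a universal constant $C\ge1$ such that, whenever $X$ is a separable Banach space with $\mathrm{Sz}(X^* )>\omega$, we have $T_\infty\overset{C}{\hookrightarrow}X$.
   Context: Banach spaces are real. $\mathbb N$ is the set of positive integers and $\omega$ is the first infinite ordinal. Tree: $T_\infty=\bigcup_{i\ge0}\mathbb N^i$ (with $\mathbb N^0=\{\emptyset\}$) is the set of all finite sequences of positive integers. $|s|$ is the length of $s$; $s\le t$ means that $t$ extends $s$ ($s$ is an ancestor of $t$; $s\le s$). It is equipped with the hyperbolic distance $\rho(s,s')=|s|+|s'|-2|u|$, where $u$ is the greatest common ancestor (longest common initial segment) of $s$ and $s'$. Embeddings: for an injective map $f:(M,d)\to(N,\delta)$ between metric spaces, $\mathrm{dist}(f)=\sup_{x\ne y}\frac{\delta(f(x),f(y))}{d(x,y)}\cdot\sup_{x\ne y}\frac{d(x,y)}{\delta(f(x),f(y))}$. We write $M\overset{C}{\hookrightarrow}N$ if there is an injective $f:M\to N$ with $\mathrm{dist}(f)\le C$. Banach spaces carry the norm metric. Szlenk index of a Banach space $Z$ (applied here to $Z=X^*$): for a weak$^*$-compact $K\subset Z^*$ and $\varepsilon>0$, $s_\varepsilon K=K\setminus\bigcup\{V: V\in\mathcal V\}$, where $\mathcal V$ is the set of relatively weak$^*$-open subsets $V$ of $K$ with norm diameter less than $\varepsilon$. Set $s^0_\varepsilon K=K$, $s_\varepsilon^{\alpha+1}K=s_\varepsilon(s_\varepsilon^\alpha K)$, and $s_\varepsilon^\alpha K=\bigcap_{\beta<\alpha}s_\varepsilon^\beta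 K$ for limit ordinals $\alpha$. $\mathrm{Sz}(Z,\varepsilon)$ is the least ordinal $\alpha$ with $s_\varepsilon^\alpha B_{Z^*}=\emptyset$ ($B_{Z^*}$ the closed unit ball of $Z^*$) if it exists, and $\mathrm{Sz}(Z,\varepsilon)=\infty$ otherwise, where $\infty$ is larger than every ordinal. Finally $\mathrm{Sz}(Z)=\sup_{\varepsilon>0}\mathrm{Sz}(Z,\varepsilon)$. *)

(* Defs.v *)
From HB Require Import structures.
From mathcomp Require Import all_boot all_order all_algebra.
From mathcomp Require Import all_classical all_reals all_analysis.

Set Implicit Arguments.
Unset Strict Implicit.
Unset Printing Implicit Defensive.

Import Order.TTheory GRing.Theory Num.Theory.
Import numFieldNormedType.Exports.

Local Open Scope classical_set_scope.
Local Open Scope ring_scope.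

Section Dual.
Context {R : realType} (X : normedModType R).

Definition dual_pred : {pred X -> R^o} :=
  fun f => `[< linear f /\ continuous f >].

Record dual := Dual { dual_fun : X -> R^o ; _ : dual_fun \in dual_pred }.

HB.instance Definition _ := [isSub for dual_fun].
HB.instance Definition _ := [Choice of dual by <:].

Lemma dual_pred_submod_closed : submod_closed dual_pred.
Proof.
split.
  apply/asboolP; split; last by move=> x; exact: cvg_cst.
  by move=> a x y /=; rewrite scaler0 addr0.
move=> a f g /asboolP[lf cf] /asboolP[lg cg]; apply/asboolP; split.
  move=> b x y.
  rewrite /GRing.add /GRing.scale /= /GRing.scale /= in lf lg *.
  by rewrite lf lg !mulrDr addrACA mulrCA.
move=> x; have -> : a *: f + g = (fun x => a *: f x + g x) by [].
by apply: cvgD; [apply: cvgZr; exact: cf|exact: cg].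
Qed.

HB.instance Definition _ :=
  GRing.isSubmodClosed.Build R (X -> R^o) dual_pred dual_pred_submod_closed.
HB.instance Definition _ := [SubChoice_isSubLmodule of dual by <:].

Lemma dual_linear (f : dual) : linear (dual_fun f).
Proof. by case: f => f /= /asboolP[]. Qed.

Lemma dual_continuous (f : dual) : continuous (dual_fun f).
Proof. by case: f => f /= /asboolP[]. Qed.

Lemma dual_funD (f g : dual) x : dual_fun (f + g) x = dual_fun f x + dual_fun g x.
Proof. by []. Qed.

Lemma dual_funZ a (f : dual) x : dual_fun (a *: f) x = a * dual_fun f x.
Proof. by []. Qed.

Lemma dual_ext (f g : dual) : dual_fun f =1 dual_fun g -> f = g.
Proof. by move=> fg; apply: val_inj; apply/funext. Qed.

Definition dual_norm (f : dual) : R :=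
  sup [set `|dual_fun f x| | x in [set x : X | `|x| <= 1]].

Lemma dual_norm_has_sup (f : dual) :
  has_sup [set `|dual_fun f x| | x in [set x : X | `|x| <= 1]].
Proof.
pose g : {linear X -> R^o} :=
  HB.pack (dual_fun f) (GRing.isLinear.Build _ _ _ _ _ (dual_linear f)).
split; first by exists `|dual_fun f 0|, 0 => //=; rewrite normr0.
have cg : continuous g by exact: dual_continuous.
have /bounded_funP /(_ 1)[M gM] := (linear_bounded_continuous g).2 cg.
by exists M => _ [x x1 <-]; exact: gM.
Qed.

Lemma dual_norm_le1 (f : dual) x : `|x| <= 1 -> `|dual_fun f x| <= dual_norm f.
Proof.
by move=> x1; apply: ub_le_sup; [exact: (dual_norm_has_sup f).2|exists x].
Qed.

Lemma dual_norm_ub (f : dual) M :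
  (forall x, `|x| <= 1 -> `|dual_fun f x| <= M) -> dual_norm f <= M.
Proof.
move=> fM; apply: ge_sup; first exact: (dual_norm_has_sup f).1.
by move=> _ [x x1 <-]; exact: fM.
Qed.

Lemma dual_norm_ge0 (f : dual) : 0 <= dual_norm f.
Proof.
by apply: (le_trans (normr_ge0 (dual_fun f 0))); apply: dual_norm_le1; rewrite normr0.
Qed.

Lemma dual_fun0 (f : dual) : dual_fun f 0 = 0.
Proof.
have := dual_linear f 1 0 0.
by rewrite scale1r addr0 scale1r => /eqP; rewrite -subr_eq0 opprD addNKr oppr_eq0 => /eqP.
Qed.

Lemma dual_funZr (f : dual) a x : dual_fun f (a *: x) = a * dual_fun f x.
Proof. by have := dual_linear f a x 0; rewrite addr0 dual_fun0 addr0. Qed.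

Lemma dual_normD (f g : dual) : dual_norm (f + g) <= dual_norm f + dual_norm g.
Proof.
apply: dual_norm_ub => x x1; rewrite dual_funD.
by apply: (le_trans (ler_normD _ _)); apply: lerD; exact: dual_norm_le1.
Qed.

Lemma dual_normZ (a : R) (f : dual) : dual_norm (a *: f) = `|a| * dual_norm f.
Proof.
have le (b : R) (g : dual) : dual_norm (b *: g) <= `|b| * dual_norm g.
  apply: dual_norm_ub => x x1; rewrite dual_funZ normrM.
  by apply: ler_wpM2l => //; exact: dual_norm_le1.
apply/eqP; rewrite eq_le le /=.
have [->|a0] := eqVneq a 0; first by rewrite normr0 mul0r dual_norm_ge0.
rewrite -ler_pdivlMl ?normr_gt0// -normfV.
by rewrite -{1}[f]scale1r -(mulVf a0) -scalerA le.
Qed.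

Lemma dual_norm0_eq0 (f : dual) : dual_norm f = 0 -> f = 0.
Proof.
move=> f0; apply: dual_ext => x.
have [->|x0] := eqVneq x 0; first exact: dual_fun0.
have := @dual_norm_le1 f (`|x|^-1 *: x); rewrite normfZV// lexx f0 => /(_ isT).
rewrite normr_le0 dual_funZr mulf_eq0 invr_eq0 normr_eq0 (negbTE x0) /=.
by move=> /eqP.
Qed.

HB.instance Definition _ :=
  Lmodule_isNormed.Build R dual dual_normD dual_normZ dual_norm0_eq0.

End Dual.

Definition weak_star {R : realType} (Z : normedModType R) : topologicalType :=
  initial_topology (fun f : dual Z => dual_fun f : {ptws Z -> R^o}).

(* [osup f] stands for the least upper bound of the family [f], so that every
   limit ordinal is the [osup] of a family cofinal in it. An ordinal has several
   representations; [ole] and [olt] do not depend on them. *)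
Inductive ord : Type :=
| ozero
| osucc of ord
| osup (I : Type) of (I -> ord).

Fixpoint ole (a : ord) : ord -> Prop :=
  match a with
  | ozero => fun _ : ord => True
  | osucc a' =>
      (* [lt b] is a' < b, which is the same as a' + 1 <= b *)
      fix lt (b : ord) : Prop :=
        match b with
        | ozero => False
        | osucc b' => ole a' b'
        | osup _ g => exists i, lt (g i)
        end
  | osup _ f => fun b => forall i, ole (f i) b
  end.

Definition olt (a b : ord) : Prop := ole (osucc a) b.

Definition omega : ord := osup (fun n : nat => iter n osucc ozero).

(* Ordinals extended with [None], which plays the role of the symbol oo. *)
Definition xord := option ord.

Definition xlt (a b : xord) : Prop :=
  match a, b with
  | Some a', Some b' => olt a' b'
  | Some _, None => True
  | None, _ => False
  end.

Definition xsup (I : Type) (f : I -> xord) : xord :=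
  if pselect (exists i, f i = None) then None
  else Some (osup (fun i => odflt ozero (f i))).

Definition is_least (P : ord -> Prop) (a : ord) : Prop :=
  P a /\ forall b, P b -> ole a b.

Definition xleast (P : ord -> Prop) : xord :=
  if pselect (exists a, is_least P a) is left ex then Some (projT1 (cid ex))
  else None.

Section Szlenk.
Context {R : realType} (Z : normedModType R).

Definition norm_diam (V : set (dual Z)) : \bar R :=
  ereal_sup [set `|p.1 - p.2|%:E | p in V `*` V].

Definition rel_weak_star_open (K V : set (dual Z)) : Prop :=
  exists2 U : set (weak_star Z), open U & V = K `&` U.

Definition szlenk_derivative (e : R) (K : set (dual Z)) : set (dual Z) :=
  K `\` \bigcup_(V in [set V | rel_weak_star_open K V /\ (norm_diam V < e%:E)%E]) V.

(* At [osup f] the intersection over all smaller ordinals is the intersection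
   over the family [f], since the derived sets decrease; [K] itself is only
   needed when the family is empty, that is, when [osup f] is zero. *)
Fixpoint szlenk_derived (e : R) (K : set (dual Z)) (a : ord) : set (dual Z) :=
  match a with
  | ozero => K
  | osucc a' => szlenk_derivative e (szlenk_derived e K a')
  | osup _ f => K `&` \bigcap_i szlenk_derived e K (f i)
  end.

Definition dual_ball : set (dual Z) := [set f | `|f| <= 1].

Definition szlenk_eps (e : R) : xord :=
  xleast (fun a => szlenk_derived e dual_ball a = set0).

Definition szlenk : xord := xsup (fun e : {e : R | 0 < e} => szlenk_eps (sval e)).

End Szlenk.

Definition separable (T : topologicalType) : Prop :=
  exists2 D : set T, countable D & dense D.

Section Embedding.
Context {R : realType} (M N : Type) (d : M -> M -> R) (delta : N -> N -> R).

Definition distortion (f : M -> N) : \bar R :=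
  (ereal_sup [set (delta (f p.1) (f p.2) / d p.1 p.2)%:E
               | p in [set p : M * M | p.1 <> p.2]]
   * ereal_sup [set (d p.1 p.2 / delta (f p.1) (f p.2))%:E
                 | p in [set p : M * M | p.1 <> p.2]])%E.

Definition embeds_with (C : R) : Prop :=
  exists2 f : M -> N, injective f & (distortion f <= C%:E)%E.

End Embedding.

Definition norm_dist {R : realType} (X : normedModType R) (x y : X) : R := `|x - y|.

Definition tree : Type := seq {n : nat | (0 < n)%N}.

Fixpoint greatest_common_ancestor (s t : tree) : tree :=
  match s, t with
  | x :: s', y :: t' => if x == y then x :: greatest_common_ancestor s' t' else [::]
  | _, _ => [::]
  end.

Definition tree_dist (R : realType) (s t : tree) : R :=
  (size s)%:R + (size t)%:R - 2 * (size (greatest_common_ancestor s t))%:R.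

(* Main.v *)
Require Import Defs.
From HB Require Import structures.
From mathcomp Require Import all_boot all_order all_algebra.
From mathcomp Require Import all_classical all_reals all_analysis.
From mathcomp Require Import zify ring lra.

(** Write [Y] for the dual of [X] and [B] for the unit ball of the dual of [Y]. The
    vectors of the embedding come from trees in [B], whose branching is weak*
    convergence and whose edges have length bounded below.

    If the Szlenk index of [Y] exceeds omega, there is a scale [e] at which no
    finite number of derivations empties [B] ([szlenk_gt_omega_finite]). Since the
    number of derivations that empty [B] is submultiplicative in the scale, the
    same holds at the scale [1 / 2], and then, by convexity and symmetry of [B],
    the point [0] belongs to all the derived sets at the scale [1 / 4]
    ([szlenk_gt_omega_wder]). This is what makes the distortion universal.

    A point [z] of a derived set is a weak* limit of points [y] of the previous
    derived set with [`|y - z| > 1 / 4]. Given a finite-dimensional subspace [E] of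
    the bidual, [y - z] is eventually at distance at least [1 / 12] from [E], because
    [E] is normed by finitely many elements of [Y]; by Helly's theorem some [g] in
    [Y] with [`|g| <= 12] almost vanishes on [E] and has [(y - z) g] close to [1]
    ([wder_separation]). By Goldstine's theorem [y] may be replaced, as far as finitely
    many functionals are concerned, by a vector of the unit ball of [X].

    The infinite tree is cut into blocks of levels, from [2 ^ j] to
    [2 ^ (j + 1) - 1], and its nodes are enumerated so that ancestors come first.
    Along this enumeration one chooses for each node [v] a point of [B] close to that
    of its parent, or to [0] at the beginning of a block, a functional [g_v] as
    above, and a vector [x_v] of the unit ball that imitates the point of [v]
    ([exists_admissible]). The result is that [g_v] is almost at least [1 / 2] at
    [x_w] if [w] is [v] or a descendant of [v] in the same block, and almost zero at
    all the other [x_w] ([vec_branch]). A block needs only finitely many derivations,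
    which is why no infinite derivation is required.

    The embedding maps [s] to the sum of the [x_w] over the nonempty initial
    segments [w] of [s]. It is [1]-Lipschitz. If [n] ancestors of [s] are not
    ancestors of [t], one of them, [v], has at least [n / 4] descendants, itself
    included, on the branch of [s] and in its block ([block_interval]), so that [g_v]
    takes a value of order [n / 8] at the difference of the images of [s] and [t]. *)

Set Implicit Arguments.
Unset Strict Implicit.
Unset Printing Implicit Defensive.

Import Order.TTheory GRing.Theory Num.Theory.
Import numFieldNormedType.Exports.

Local Open Scope classical_set_scope.
Local Open Scope ring_scope.

(** * Finite ordinals and the Szlenk derivation *)

(** The finite ordinal [n]. *)
Notation ord_of_nat n := (iter n osucc ozero).

Lemma ole_succ_finite (b : ord) (n : nat) :
  ole (ord_of_nat n.+1) b -> ole b (ord_of_nat n) -> False.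
Proof.
elim: b n => [|b IH|I f IH] n; [by []| |by move=> [i lei] le; exact: (IH i n)].
by case: n => [|n] //; exact: IH.
Qed.

Lemma olt_omega_finite (b : ord) (n : nat) :
  olt omega b -> ole (ord_of_nat n.+1) b.
Proof.
by elim: b n => [|b _|I f IH] n //= [i ltf]; exists i; exact: IH.
Qed.

Section SzlenkDerivation.
Context {R : realType} (Z : normedModType R).
Implicit Types (K L : set (dual Z)) (e : R).

Lemma szlenk_derivative_sub e K : szlenk_derivative e K `<=` K.
Proof. by move=> f []. Qed.

Lemma szlenk_derivativeS e K L :
  K `<=` L -> szlenk_derivative e K `<=` szlenk_derivative e L.
Proof.
move=> KL f [Kf nK]; split; first exact: KL.
move=> [V [[U oU ->] dV] [_ Uf]]; apply: nK; exists (K `&` U) => //.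
split; first by exists U.
apply: le_lt_trans dV; apply: ereal_sup_le => _ [[p q] [[Kp Up] [Kq Uq]] <-] /=.
by exists (p, q) => //; split; split => //; exact: KL.
Qed.

Lemma szlenk_derived_finite_sub e K m n : (m <= n)%N ->
  szlenk_derived e K (ord_of_nat n) `<=` szlenk_derived e K (ord_of_nat m).
Proof.
move=> /subnKC <-; elim: (n - m)%N => [|k IH]; first by rewrite addn0.
by rewrite addnS; apply: subset_trans IH; exact: szlenk_derivative_sub.
Qed.

(** An ordinal [b] that is not at least [n] is at most some [m < n], so its derived
    set contains the [m]-th one. *)
Lemma ole_finite_or_derived_sub e K (b : ord) (n : nat) :
  ole (ord_of_nat n) b \/ exists2 m, (m < n)%N &
    szlenk_derived e K (ord_of_nat m) `<=` szlenk_derived e K b.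
Proof.
elim: b n => [|b IH|I f IH] [|n]; try by left.
- by right; exists 0%N.
- have [le|[m mn sub]] := IH n; [by left|right; exists m.+1 => //].
  exact: szlenk_derivativeS.
- have [[i lei]|nle] := pselect (exists i, ole (ord_of_nat n.+1) (f i)).
    by left; exists i.
  right; exists n => // z zn; split.
    exact: (@szlenk_derived_finite_sub e K 0 n).
  move=> i _; have [lei|[m mn sub]] := IH i n.+1; first by case: nle; exists i.
  by apply: sub; exact: szlenk_derived_finite_sub zn.
Qed.

(** If the [n]-th derived set were empty, the least such [n] would be the Szlenk
    index at the scale [e], which is then finite. *)
Lemma szlenk_gt_omega_finite : xlt (Some omega) (szlenk Z) ->
  exists2 e : R, 0 < e & forall n,
    szlenk_derived e (@dual_ball R Z) (ord_of_nat n) !=set0.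
Proof.
rewrite /szlenk /xsup; case: pselect => [[[e e0] /= sz]|nN /= [[e e0]]].
  move=> _; exists e => // n0; apply/set0P/eqP => sn0.
  have ex : exists n, `[< szlenk_derived e (@dual_ball R Z) (ord_of_nat n) = set0 >].
    by exists n0; apply/asboolP.
  case: (ex_minnP ex) => n /asboolP sn minn.
  move: sz; rewrite /szlenk_eps /xleast; case: pselect => // nl _; apply: nl.
  exists (ord_of_nat n); split => // b sb.
  have [//|[m mn sub]] := ole_finite_or_derived_sub e (@dual_ball R Z) b n.
  have /minn : `[< szlenk_derived e (@dual_ball R Z) (ord_of_nat m) = set0 >].
    by apply/asboolP/seteqP; split => // z /sub; rewrite sb.
  by rewrite leqNgt mn.
move=> lt; exists e => // n; apply/set0P/eqP => sn.
move: lt => /=; rewrite /szlenk_eps /xleast; case: pselect => [ex|]; last by [].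
case: (cid _) => a [_ mina] /= lt.
exact: ole_succ_finite (olt_omega_finite n lt) (mina _ sn).
Qed.

End SzlenkDerivation.

(** * Derivation through basic weak* neighbourhoods *)

Section Dual.
Context {R : realType} (V : normedModType R).
Implicit Types (f g : dual V) (x y : V).

Lemma dual_fun_le f x : `|dual_fun f x| <= `|f| * `|x|.
Proof.
have [->|x0] := eqVneq x 0; first by rewrite dual_fun0 !normr0 mulr0.
have := @dual_norm_le1 _ _ f (`|x|^-1 *: x).
rewrite normfZV// lexx dual_funZr normrM normfV normr_id => /(_ isT).
by rewrite mulrC ler_pdivrMr ?normr_gt0.
Qed.

Lemma dual_funB f g x : dual_fun (f - g) x = dual_fun f x - dual_fun g x.
Proof. by []. Qed.

Lemma dual_funDr f x y : dual_fun f (x + y) = dual_fun f x + dual_fun f y.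
Proof. by have := dual_linear f 1 x y; rewrite !scale1r. Qed.

Lemma dual_funBr f x y : dual_fun f (x - y) = dual_fun f x - dual_fun f y.
Proof. by rewrite dual_funDr -(scaleN1r y) dual_funZr mulN1r. Qed.

Lemma dual_fun_sum I (r : seq I) (P : pred I) (F : I -> dual V) x :
  dual_fun (\sum_(i <- r | P i) F i) x = \sum_(i <- r | P i) dual_fun (F i) x.
Proof. by elim/big_rec2: _ => // i f a _ <-. Qed.

Lemma dual_fun_sumr I (r : seq I) (P : pred I) (F : I -> V) f :
  dual_fun f (\sum_(i <- r | P i) F i) = \sum_(i <- r | P i) dual_fun f (F i).
Proof.
by elim/big_rec2: _ => [|i x a _ <-]; rewrite ?dual_fun0// dual_funDr.
Qed.

Lemma dual_norm_approx f (e : R) : 0 < e ->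
  exists2 x, `|x| <= 1 & `|f| - e < dual_fun f x.
Proof.
move=> e0; have [_ [x x1 <-] lt] := sup_adherent e0 (dual_norm_has_sup f).
case: (ltrP (dual_fun f x) 0) => fx0; last by exists x; rewrite // -(ger0_norm fx0).
exists (- x); first by rewrite normrN.
by rewrite -(scaleN1r x) dual_funZr mulN1r -(ltr0_norm fx0).
Qed.

End Dual.

Section WeakStarDerivation.
Context {R : realType} (Z : normedModType R).
Implicit Types (K L : set (dual Z)) (y z : dual Z) (G : seq Z) (a b d e : R).

(** The basic weak* neighbourhood of [z] given by finitely many vectors. *)
Definition wnbhd z G d : set (dual Z) :=
  [set y | forall g, g \in G -> `|dual_fun y g - dual_fun z g| < d].

(** The points [z] of [K] that are in the weak* closure of the set of the points
    of [K] at distance more than [e] from [z]. In contrast with the Szlenk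
    derivation, this involves neither diameters nor arbitrary open sets. *)
Definition wder e K : set (dual Z) :=
  [set z | K z /\ forall G d, 0 < d ->
     exists2 y, (K `&` wnbhd z G d) y & e < `|y - z|].

Lemma wnbhd_center z G d : 0 < d -> wnbhd z G d z.
Proof. by move=> d0 g _; rewrite subrr normr0. Qed.

Lemma wnbhd_cons z g G d :
  wnbhd z (g :: G) d = [set y | `|dual_fun y g - dual_fun z g| < d] `&` wnbhd z G d.
Proof.
apply/seteqP; split => y /=.
  move=> yz; split; first by apply: yz; rewrite mem_head.
  by move=> h hG; apply: yz; rewrite inE hG orbT.
by move=> [yg yG] h; rewrite inE => /orP[/eqP ->//|]; exact: yG.
Qed.

Lemma open_wnbhd z G d : open (wnbhd z G d : set (weak_star Z)).
Proof.
elim: G => [|g G IH].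
  by rewrite (_ : wnbhd z [::] d = setT); [exact: openT|apply/seteqP; split].
rewrite wnbhd_cons; apply: (@openI (weak_star Z)) => //.
have cg : continuous ((fun f : {ptws Z -> R^o} => f g) \o
    (fun f : weak_star Z => dual_fun f : {ptws Z -> R^o})).
  move=> f; apply: continuous_comp; first exact: initial_continuous.
  exact: (@proj_continuous Z (fun _ => R^o) g).
have := (continuousP _).1 cg (ball (dual_fun z g : R^o) d) (ball_open _ _).
congr open; apply/seteqP.
by split => y /=; rewrite -ball_normE /= distrC.
Qed.

(** A point of a basic neighbourhood has a basic neighbourhood inside it. *)
Lemma wnbhd_sub z G d y : wnbhd z G d y ->
  exists2 d', 0 < d' & wnbhd y G d' `<=` wnbhd z G d.
Proof.
elim: G => [_|g G IH]; first by exists 1.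
rewrite wnbhd_cons => -[/= yg /IH[d1 d10 sub]].
exists (Num.min d1 (d - `|dual_fun y g - dual_fun z g|)).
  by rewrite lt_min d10 subr_gt0.
rewrite wnbhd_cons => w [/=]; rewrite lt_min => /andP[_ wg] wG; split; last first.
  by apply: sub => h /wG; rewrite lt_min => /andP[].
by rewrite /= -(subrKA (dual_fun y g)); apply: (le_lt_trans (ler_normD _ _)); lra.
Qed.

Lemma wder_sub e K : wder e K `<=` K.
Proof. by move=> z []. Qed.

Lemma wderS a b K L : b <= a -> K `<=` L -> wder a K `<=` wder b L.
Proof.
move=> ba KL z [Kz dz]; split=> [|G d d0]; first exact: KL.
have [y [Ky yz] ay] := dz G d d0; exists y; last exact: le_lt_trans ay.
by split => //; exact: KL.
Qed.

Lemma iter_wderS n a b K L : b <= a -> K `<=` L ->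
  iter n (wder a) K `<=` iter n (wder b) L.
Proof. by move=> ba KL; elim: n => //= n; exact: wderS. Qed.

Lemma iter_wder_sub n e K : iter n (wder e) K `<=` K.
Proof. by elim: n => //= n; apply: subset_trans; exact: wder_sub. Qed.

Lemma szlenk_derivative_wder e K : 0 < e ->
  szlenk_derivative e K `<=` wder (e / 3) K.
Proof.
move=> e0 z [Kz nz]; split => // G d d0; apply/not_exists2P => far; apply: nz.
exists (K `&` wnbhd z G d); last by split => //; exact: wnbhd_center.
split; first by exists (wnbhd z G d) => //; exact: open_wnbhd.
apply: (@le_lt_trans _ _ (e / 3 * 2)%:E); last by rewrite lte_fin; lra.
apply: ge_ereal_sup => _ [[p q] [/= Vp Vq] <-] /=; rewrite lee_fin.
have far_le w : (K `&` wnbhd z G d) w -> `|w - z| <= e / 3.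
  by move=> Vw; rewrite leNgt; apply/negP; have [] := far w.
rewrite -(subrKA z); apply: (le_trans (ler_normD _ _)).
by rewrite (distrC z) mulr_natr mulr2n lerD// far_le.
Qed.

Lemma wder_affine a c w K L : 0 < c -> (forall z, K z -> L (c *: z + w)) ->
  forall z, wder a K z -> wder (c * a) L (c *: z + w).
Proof.
move=> c0 KL z [Kz dz]; split => [|G d d0]; first exact: KL.
have cd0 : 0 < c^-1 * d by rewrite mulr_gt0// invr_gt0.
have [y [Ky yz] ay] := dz G _ cd0; exists (c *: y + w); last first.
  rewrite opprD addrACA subrr addr0 -scalerBr normrZ gtr0_norm//.
  by rewrite ltr_pM2l.
split; first exact: KL.
move=> g /yz; rewrite ltr_pdivlMl// => lt.
rewrite !dual_funD !dual_funZ opprD addrACA subrr addr0 -mulrBr.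
by rewrite normrM gtr0_norm.
Qed.

Lemma iter_wder_affine n a c w K L : 0 < c -> (forall z, K z -> L (c *: z + w)) ->
  forall z, iter n (wder a) K z -> iter n (wder (c * a)) L (c *: z + w).
Proof. by move=> c0 KL; elim: n => //= n; exact: wder_affine. Qed.

(** The derivations are local: membership of a point in a derived set depends
    only on the part of the set in a neighbourhood of that point. *)
Lemma iter_wder_local n e K z G d :
  iter n (wder e) K `&` wnbhd z G d `<=` iter n (wder e) (K `&` wnbhd z G d).
Proof.
elim: n => //= n IH y [[Ky dy] yz]; split=> [|G1 d1 d10]; first exact: IH.
have [d2 d20 sub] := wnbhd_sub yz.
have [|x [Kx xy] ex] := dy (G ++ G1) (Num.min d1 d2); first by rewrite lt_min d10.
exists x => //; split.
  apply: IH; split => //; apply: sub => g gG.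
  have := xy g; rewrite mem_cat gG => /(_ isT).
  by rewrite lt_min => /andP[].
move=> g gG1; have := xy g; rewrite mem_cat gG1 orbT => /(_ isT).
by rewrite lt_min => /andP[].
Qed.

(** Close to a point of [K] outside [wder b K], the set [K] lies in a ball of
    radius [b], which is emptied by [N] derivations at the scale [a * b]. *)
Lemma iter_wder_mul_sub N a b K : 0 < b ->
  iter N (wder a) (@dual_ball R Z) = set0 ->
  iter N (wder (a * b)) K `<=` wder b K.
Proof.
move=> b0 aN z zN; have Kz := iter_wder_sub zN.
split => // G d d0; apply/not_exists2P => far.
have := @iter_wder_local N (a * b) K z G d z (conj zN (@wnbhd_center z G d d0)).
have b'0 : 0 < b^-1 by rewrite invr_gt0.
move=> /(@iter_wder_affine N _ _ (- (b^-1 *: z)) _ (@dual_ball R Z) b'0).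
rewrite [b^-1 * _]mulrC mulfK ?gt_eqF// aN; apply => y Ky /=.
rewrite -scalerBr /dual_ball /= normrZ gtr0_norm// ler_pdivrMl// mulr1 leNgt.
by apply/negP; have [] := far y.
Qed.

Lemma iter_wder_mul N M a b K : 0 < b ->
  iter N (wder a) (@dual_ball R Z) = set0 ->
  iter (M * N) (wder (a * b)) K `<=` iter M (wder b) K.
Proof.
move=> b0 aN; elim: M => //= M IH.
rewrite mulSn iterD; apply: subset_trans (iter_wder_mul_sub b0 aN).
exact: iter_wderS.
Qed.

Lemma iter_wder_exp N a k : 0 < a ->
  iter N (wder a) (@dual_ball R Z) = set0 ->
  iter (N ^ k.+1) (wder (a ^+ k.+1)) (@dual_ball R Z) = set0.
Proof.
move=> a0 aN; elim: k => [|k IH]; first by rewrite expn1 expr1.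
apply/seteqP; split => // z; rewrite expnSr exprS => /iter_wder_mul.
by rewrite IH; apply => //; exact: exprn_gt0.
Qed.

(** The number of derivations needed to empty the ball is submultiplicative in
    the scale: if it were finite at the scale [1 / 2], it would be finite at the
    scale [(1 / 2) ^+ k] for all [k], hence at every scale. *)
Lemma iter_wder_half_nonempty e : 0 < e ->
  (forall n, iter n (wder e) (@dual_ball R Z) !=set0) ->
  forall n, iter n (wder (1 / 2)) (@dual_ball R Z) !=set0.
Proof.
move=> e0 en n; apply/set0P/eqP => hn.
pose k := Num.bound e^-1; have [z] := en (n ^ k.+1)%N.
suff : (1 / 2 : R) ^+ k.+1 <= e.
  have h0 : (0 : R) < 1 / 2 by lra.
  move=> ke /(iter_wderS ke (@subset_refl _ _)).
  have /seteqP[empty _] := iter_wder_exp k h0 hn.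
  exact: empty.
rewrite div1r exprVn -[leRHS]invrK lef_pV2 ?posrE ?invr_gt0 ?exprn_gt0//.
apply: (@le_trans _ _ k%:R).
  by apply/ltW/archi_boundP; rewrite invr_ge0 ltW.
by rewrite -natrX ler_nat (leq_trans (ltnW (ltn_expl k (leqnn 2))))// leq_exp2l.
Qed.

(** The half sum of [- z] and of a point of a derived set of the ball stays in the
    derived set at half the scale; it is [0] when that point is [z]. *)
Lemma iter_wder_quarter0 n : iter n (wder (1 / 2)) (@dual_ball R Z) !=set0 ->
  iter n (wder (1 / 4)) (@dual_ball R Z) 0.
Proof.
move=> [z zn]; have zB := iter_wder_sub zn.
have h0 : (0 : R) < 1 / 2 by lra.
have := @iter_wder_affine n (1 / 2) _ (- ((1 / 2) *: z)) _ (@dual_ball R Z) h0 _ z zn.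
rewrite subrr; have -> : 1 / 2 * (1 / 2) = 1 / 4 :> R by lra.
apply => y yB; rewrite /dual_ball /= in yB zB *.
apply: (le_trans (ler_normB _ _)); rewrite (normrZ _ y) (normrZ _ z) (gtr0_norm h0); lra.
Qed.

End WeakStarDerivation.

Lemma szlenk_gt_omega_wder {R : realType} (Z : normedModType R) :
  xlt (Some omega) (szlenk Z) ->
  forall n, iter n (wder (1 / 4)) (@dual_ball R Z) 0.
Proof.
move=> /szlenk_gt_omega_finite[e e0 en] n; apply: iter_wder_quarter0.
apply: (@iter_wder_half_nonempty _ _ (e / 3)); first by lra.
move=> {}n; have [z zn] := en n; exists z.
elim: n z zn => // n IH z /szlenk_derivativeS - /(_ _ IH).
exact: szlenk_derivative_wder.
Qed.

(** * Helly's and Goldstine's theorems *)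

Section Helly.
Context {R : realType}.

(** Helly's theorem: the quadratic error of a near-minimiser over the ball of
    radius [M] is the vector of coefficients of a functional that would violate
    the hypothesis if that error were bounded away from zero. *)
Lemma helly (W : normedModType R) (phi : seq (dual W)) (v : nat -> R) (M d : R) :
  0 < M -> 0 < d ->
  (forall c : nat -> R, `|\sum_(i < size phi) c i * v i| <=
     M * `|\sum_(i < size phi) c i *: phi`_i|) ->
  exists2 w : W, `|w| <= M &
    forall i, (i < size phi)%N -> `|dual_fun phi`_i w - v i| <= d.
Proof.
move=> M0 d0 hyp; apply/not_exists2P => no.
pose Q w := \sum_(i < size phi) (v i - dual_fun phi`_i w) ^+ 2.
pose A := [set Q w | w in [set w : W | `|w| <= M]].
have Q_ge w : `|w| <= M -> d ^+ 2 <= Q w.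
  move=> wM; have [//|/existsNP[i /not_implyP[isz /negP]]] := no w.
  rewrite -ltNge => lt; rewrite /Q (bigD1 (Ordinal isz))//=.
  rewrite -[leLHS]addr0 lerD//; last by apply: sumr_ge0 => j _; exact: sqr_ge0.
  by rewrite -[leRHS]real_normK ?num_real// distrC lerXn2r ?nnegrE// ltW.
have A0 : A !=set0 by exists (Q 0), 0 => //=; rewrite normr0 ltW.
have Ainf : has_inf A.
  by split => //; exists (d ^+ 2) => _ [w wM <-]; exact: Q_ge.
set I := inf A.
have I0 : 0 < I.
  apply: (lt_le_trans (exprn_gt0 2 d0)).
  by apply: lb_le_inf => // _ [w wM <-]; exact: Q_ge.
have I_le w : `|w| <= M -> I <= Q w.
  by move=> wM; apply: ge_inf; [exact: Ainf.2|exists w].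
pose L := \sum_(i < size phi) (`|phi`_i| * (2 * M)) ^+ 2 + 1.
have L0 : 0 < L by rewrite ltr_wpDl// sumr_ge0// => i _; exact: sqr_ge0.
pose t := Num.min 1 (I / (2 * L)).
have t0 : 0 < t by rewrite lt_min ltr01 divr_gt0// mulr_gt0.
have t1 : t <= 1 by rewrite ge_min lexx.
have tL : t * L <= I / 2.
  have : t <= I / (2 * L) by rewrite ge_min lexx orbT.
  rewrite ler_pdivlMr ?mulr_gt0// => tl; lra.
have [|_ [w /= wM <-] wI] := @inf_adherent _ A (t * I / 2) _ Ainf.
  by rewrite divr_gt0// mulr_gt0.
rewrite -/I in wI.
(* The vector of errors at the near-minimiser [w]. *)
pose c i := v i - dual_fun phi`_i w.
pose F := \sum_(i < size phi) c i *: phi`_i.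
have FE x : dual_fun F x = \sum_(i < size phi) c i * dual_fun phi`_i x.
  by rewrite dual_fun_sum; apply: eq_bigr => i _; rewrite dual_funZ.
have F_le w' : `|w'| <= M -> dual_fun F w' <= \sum_(i < size phi) c i * v i - I / 2.
  move=> w'M.
  have wt : `|w + t *: (w' - w)| <= M.
    have -> : w + t *: (w' - w) = (1 - t) *: w + t *: w'.
      by rewrite scalerBr scalerBl scale1r addrA [RHS]addrAC.
    rewrite (le_trans (ler_normD _ _))// !normrZ (gtr0_norm t0) ger0_norm ?subr_ge0//.
    have : (1 - t) * `|w| <= (1 - t) * M by rewrite ler_wpM2l// subr_ge0.
    have : t * `|w'| <= t * M by rewrite ler_wpM2l// ltW.
    lra.
  (* [w] nearly minimises [Q] on the segment towards [w'] too. *)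
  have := I_le _ wt.
  pose p i := dual_fun phi`_i (w' - w).
  have -> : Q (w + t *: (w' - w)) = Q w - 2 * t * dual_fun F (w' - w) +
      t ^+ 2 * \sum_(i < size phi) p i ^+ 2.
    rewrite FE !mulr_sumr /Q -sumrB -big_split /=; apply: eq_bigr => i _.
    rewrite dual_funDr dual_funZr -/(p i) /c; ring.
  have pL : \sum_(i < size phi) p i ^+ 2 <= L.
    apply: (@le_trans _ _ (L - 1)); last by rewrite gerBl.
    rewrite /L addrK ler_sum// => i _.
    rewrite -(real_normK (num_real (p i))) lerXn2r ?nnegrE//.
      by rewrite mulr_ge0// mulr_ge0// ltW.
    rewrite (le_trans (dual_fun_le _ _))// ler_wpM2l//.
    rewrite (le_trans (ler_normB _ _))//; lra.
  have Qw : \sum_(i < size phi) c i * v i - dual_fun F w = Q w.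
    rewrite FE -sumrB; apply: eq_bigr => i _; rewrite /c; ring.
  rewrite dual_funBr; move: wI (I_le _ wM).
  have : t * (t * \sum_(i < size phi) p i ^+ 2) <= t * (t * L).
    by rewrite !ler_wpM2l// ltW.
  have : t * (t * L) <= t * (I / 2) by rewrite ler_wpM2l// ltW.
  move=> h1 h2 h3 h4 h5.
  have : t * (dual_fun F w' - dual_fun F w) <= t * (I / 2).
    rewrite expr2 -mulrA in h5; lra.
  rewrite ler_pM2l//; lra.
have [|x x1 xF] := @dual_norm_approx _ _ F (I / (4 * M)).
  by rewrite divr_gt0// mulr_gt0.
have : `|M *: x| <= M by rewrite normrZ gtr0_norm// ler_piMr// ltW.
move=> /F_le; rewrite dual_funZr => Fx.
have cv := hyp c; rewrite -/F in cv.
have : M * (`|F| - I / (4 * M)) < M * dual_fun F x by rewrite ltr_pM2l.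
have -> : M * (`|F| - I / (4 * M)) = M * `|F| - I / 4 by field; rewrite gt_eqF.
have := le_trans (ler_norm _) cv; lra.
Qed.

(** The canonical embedding of a normed space into its bidual. *)
Section Bidual.
Context (X : normedModType R).

Lemma bidual_subproof (x : X) :
  (fun f : dual X => dual_fun f x : R^o) \in @dual_pred R (dual X).
Proof.
apply/asboolP; split; first by [].
pose ev : {linear dual X -> R^o} :=
  HB.pack (fun f : dual X => dual_fun f x : R^o)
   (GRing.isLinear.Build R (dual X) R^o _ (fun f : dual X => dual_fun f x : R^o)
     (fun a f g => erefl)).
apply: (@bounded_linear_continuous _ _ _ ev); apply/bounded_funP => r.
exists (r * `|x|) => f fr /=; apply: (le_trans (dual_fun_le _ _)).
exact: ler_wpM2r.
Qed.

Definition bidual (x : X) : dual (dual X) := Dual (bidual_subproof x).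

Lemma goldstine (z : dual (dual X)) (G : seq (dual X)) (d : R) :
  `|z| <= 1 -> 0 < d -> exists2 x : X, `|x| <= 1 &
    forall h, h \in G -> `|dual_fun h x - dual_fun z h| <= d.
Proof.
move=> z1 d0; have [||c|x x1 xG] := @helly X G (fun i => dual_fun z G`_i) 1 d => //.
  rewrite mul1r; set F := \sum_(i < _) _ *: _.
  have <- : dual_fun z F = \sum_(i < size G) c i * dual_fun z G`_i.
    by rewrite dual_fun_sumr; apply: eq_bigr => i _; rewrite dual_funZr.
  by rewrite (le_trans (dual_fun_le _ _))// ler_piMl.
exists x => // h hG; have := xG (index h G).
by rewrite index_mem nth_index//; apply.
Qed.

End Bidual.

(** * Finite-dimensional subspaces *)

Section Span.
Context (V : lmodType R).

(** The linear span of a list. *)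
Fixpoint lspan (s : seq V) : set V :=
  if s is e :: s' then [set y | exists t, exists2 u, lspan s' u & y = t *: e + u]
  else [set 0].

Lemma lspan0 s : lspan s 0.
Proof.
by elim: s => //= e s IH; exists 0, 0; rewrite // scale0r addr0.
Qed.

Lemma lspanZ s a u : lspan s u -> lspan s (a *: u).
Proof.
elim: s u => /= [u ->|e s IH _ [t [u us ->]]]; first by rewrite scaler0.
by exists (a * t), (a *: u); [exact: IH|rewrite scalerDr scalerA].
Qed.

Lemma lspanD s u w : lspan s u -> lspan s w -> lspan s (u + w).
Proof.
elim: s u w => /= [u w -> ->|e s IH _ _ [t [u us ->]] [r [w ws ->]]].
  by rewrite addr0.
by exists (t + r), (u + w); [exact: IH|rewrite scalerDl addrACA].
Qed.

Lemma lspan_sum s (c : nat -> R) : lspan s (\sum_(i < size s) c i *: s`_i).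
Proof.
elim: s c => [|e s IH] c; first by rewrite big_ord0.
rewrite big_ord_recl /=; exists (c 0%N), (\sum_(i < size s) c i.+1 *: s`_i) => //.
exact: (IH (fun i => c i.+1)).
Qed.

End Span.

Lemma interval_net (T h : R) : 0 < h ->
  exists S : seq R, forall t, `|t| <= T -> exists2 r, r \in S & `|t - r| <= h.
Proof.
move=> h0; exists [seq - T + k%:R * h | k <- iota 0 (Num.trunc (2 * T / h)).+1].
move=> t; rewrite ler_norml => /andP[tT1 tT2].
have th0 : 0 <= (t + T) / h by rewrite divr_ge0 ?(ltW h0)//; lra.
have /andP[k1 k2] := truncn_itv th0.
set k := Num.trunc ((t + T) / h) in k1 k2.
exists (- T + k%:R * h).
  apply: (map_f (fun k : nat => - T + k%:R * h)); rewrite mem_iota /= add0n ltnS.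
  by apply: le_truncn; rewrite ler_pM2r ?invr_gt0//; lra.
rewrite ler_pdivlMr// in k1; rewrite ltr_pdivrMr// -natr1 mulrDl mul1r in k2.
by rewrite ler_norml; apply/andP; split; lra.
Qed.

(** Bounded sets of a finitely generated subspace are totally bounded. By
    induction: either the new generator [e] is at positive distance from the span
    of the others, and the coefficient of [e] is bounded, or it is a limit of
    points of that span, and the net of the latter is good enough. *)
Lemma lspan_net (V : normedModType R) (s : seq V) (M d : R) : 0 < d ->
  exists F : seq V, forall y, lspan s y -> `|y| <= M ->
    exists2 f, f \in F & `|y - f| <= d.
Proof.
elim: s M d => [|e s IH] M d d0.
  by exists [:: 0] => y -> _; exists 0; rewrite ?mem_head// subrr normr0 ltW.
have d20 : 0 < d / 2 by lra.
have [[c c0 far]|] := pselect (exists2 c, 0 < c & forall u, lspan s u -> c <= `|e - u|).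
  have [S SP] := @interval_net (M / c) (d / 2 / (`|e| + 1)) (divr_gt0 d20 (ltr_wpDl (normr_ge0 _) ltr01)).
  have [F FP] := IH (M + M / c * `|e|) _ d20.
  exists [seq r *: e + f | r <- S, f <- F] => _ [t [u us ->]] yM.
  have tT : `|t| <= M / c.
    rewrite ler_pdivlMr//; apply: le_trans yM.
    have [->|t0] := eqVneq t 0; first by rewrite normr0 mul0r.
    have -> : t *: e + u = t *: (e - (- t^-1) *: u).
      by rewrite scaleNr opprK scalerDr scalerA divff// scale1r.
    by rewrite normrZ ler_wpM2l// far//; exact: lspanZ.
  have [r rS rt] := SP _ tT.
  have [|f fF fu] := FP u us.
    rewrite -(addKr (t *: e) u) addrC (le_trans (ler_normB _ _))// lerD// normrZ.
    exact: ler_wpM2r.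
  exists (r *: e + f); first by apply/allpairsP; exists (r, f).
  have -> : t *: e + u - (r *: e + f) = (t - r) *: e + (u - f).
    by rewrite scalerBl opprD addrACA.
  rewrite (le_trans (ler_normD _ _))// normrZ.
  have e1 : 0 < `|e| + 1 by rewrite ltr_wpDl.
  rewrite ler_pdivlMr// in rt.
  have : `|t - r| * `|e| <= `|t - r| * (`|e| + 1) by rewrite ler_wpM2l// lerDl.
  lra.
move=> /forall2NP near0.
have [F FP] := IH (M + d) _ d20.
exists F => _ [t [u us ->]] yM.
have c0 : 0 < d / 2 / (`|t| + 1) by rewrite divr_gt0// ltr_wpDl.
have [//|/existsNP[w /not_implyP[ws /negP]]] := near0 (d / 2 / (`|t| + 1)).
rewrite -ltNge ltr_pdivlMr ?ltr_wpDl// => ew.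
have close : `|(t *: e + u) - (t *: w + u)| <= d / 2.
  rewrite opprD addrACA subrr addr0 -scalerBr normrZ.
  have : `|t| * `|e - w| <= (`|t| + 1) * `|e - w| by rewrite ler_wpM2r// lerDl.
  lra.
have [||f fF fu] := FP (t *: w + u).
- by apply: lspanD => //; exact: lspanZ.
- rewrite -(subKr (t *: e + u) (t *: w + u)) (le_trans (ler_normB _ _))//.
  lra.
exists f => //; rewrite -(subrKA (t *: w + u)) (le_trans (ler_normD _ _))//.
lra.
Qed.

Section Norming.
Context (Z : normedModType R).

(** A finitely generated subspace of the dual is normed, up to the factor
    [3 / 4], by finitely many vectors of the unit ball. *)
Lemma lspan_norming (E : seq (dual Z)) : exists2 H : seq Z,
  (forall h, h \in H -> `|h| <= 1) &
  forall y, lspan E y -> exists2 h, h \in H & 3 / 4 * `|y| <= dual_fun y h.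
Proof.
have e0 : (0 : R) < 1 / 16 by lra.
have [F FP] := @lspan_net _ E 1 _ e0.
have [norming normingP] := choice (fun f : dual Z =>
  let: ex_intro2 x x1 fx := dual_norm_approx f e0 in
  ex_intro (fun x => `|x| <= 1 /\ `|f| - 1 / 16 < dual_fun f x) x (conj x1 fx)).
exists (map norming F) => [h /mapP[f _ ->]|y Ey]; first exact: (normingP f).1.
have unit_case w : lspan E w -> `|w| <= 1 -> exists2 h, h \in map norming F &
    `|w| - 3 / 16 <= dual_fun w h.
  move=> Ew w1; have [f fF wf] := FP w Ew w1.
  exists (norming f); first exact: map_f.
  have [n1 fn] := normingP f.
  have := dual_fun_le (w - f) (norming f); rewrite dual_funB ler_norml => /andP[lo _].
  have : `|w - f| * `|norming f| <= 1 / 16 * 1 by apply: ler_pM.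
  have := lerB_dist w f; lra.
have [->|y0] := eqVneq y 0.
  have [|h hH h0] := unit_case 0 (lspan0 E); first by rewrite normr0.
  by exists h => //; rewrite normr0 mulr0.
have [||h hH hy] := unit_case (`|y|^-1 *: y).
- exact: lspanZ.
- by rewrite normfZV.
exists h => //; move: hy; rewrite normfZV// dual_funZ ler_pdivlMl ?normr_gt0//.
by rewrite mulrC; apply: le_trans; rewrite ler_wpM2r//; lra.
Qed.

(** Weak* close to a point of [wder e K] there are points of [K] whose
    difference [xi] with it has norm more than [e] and is almost annihilated by
    the vectors that norm the span of [E]; hence [xi] is at distance at least
    [e / 3] from that span, and Helly's theorem gives a vector [g] that
    separates [xi] from it. *)
Lemma wder_separation (e d : R) (K : set (dual Z)) (z : dual Z)
    (E : seq (dual Z)) (G : seq Z) : 0 < e -> 0 < d -> wder e K z ->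
  exists y g, [/\ K y, `|g| <= 3 / e, 1 - d <= dual_fun (y - z) g,
    forall x, x \in E -> `|dual_fun x g| <= d &
    forall h, h \in G -> `|dual_fun (y - z) h| <= d].
Proof.
move=> e0 d0 [Kz dz]; have [H H1 HP] := lspan_norming E.
have [|y [Ky yz] ey] := dz (G ++ H) (Num.min d (e / 6)).
  by rewrite lt_min d0 divr_gt0.
set xi := y - z in ey.
have dist_le x : lspan E x -> e / 3 <= `|xi + x|.
  move=> Ex; have [h hH hx] := HP x Ex.
  have := yz h; rewrite mem_cat hH orbT => /(_ isT).
  rewrite -dual_funB -/xi lt_min => /andP[_]; rewrite ltr_norml => /andP[xih _].
  have := dual_fun_le (xi + x) h; rewrite dual_funD => le_xix.
  have := le_trans (ler_norm _) le_xix => {}le_xix.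
  have : `|xi + x| * `|h| <= `|xi + x| by rewrite ler_piMr// H1.
  have := lerB_normD xi x.
  lra.
have [||c|g g1 gP] := @helly Z (xi :: E) (fun i => (i == 0%N)%:R) (3 / e) d => //.
- by rewrite divr_gt0.
- rewrite /= big_ord_recl big1 => [|i _]; last by rewrite mulr0.
  rewrite addr0 mulr1 big_ord_recl /=; have [->|c0] := eqVneq (c 0%N) 0.
    by rewrite normr0 mulr_ge0// divr_ge0// ltW.
  set x := \sum_(i < _) _.
  have Ex : lspan E x by exact: (@lspan_sum _ E (fun i => c i.+1)).
  have -> : c 0%N *: xi + x = c 0%N *: (xi + (c 0%N)^-1 *: x).
    by rewrite [RHS]scalerDr scalerA divff// scale1r.
  rewrite normrZ mulrCA ler_peMr//.
  have {1}-> : 1 = 3 / e * (e / 3) by field; rewrite gt_eqF.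
  by rewrite ler_wpM2l ?divr_ge0 ?(ltW e0)// dist_le//; exact: lspanZ.
exists y, g; split => //.
- have := gP 0%N isT; rewrite /= ler_norml -/xi => /andP[]; lra.
- move=> x xE; have := gP (index x E).+1; rewrite /= ltnS index_mem nth_index//.
  by rewrite subr0; apply.
- move=> h hG; have := yz h; rewrite mem_cat hG => /(_ isT).
  by rewrite lt_min => /andP[/ltW].
Qed.

End Norming.

End Helly.

(** * Blocks of levels *)

(** The levels [2 ^ j, ..., 2 ^ (j + 1) - 1] form a block; level [0] is put in
    the block of level [1]. *)
Definition block (l : nat) : nat := trunc_log 2 l.

(** The number of levels of the block of [l] that are above [l]. *)
Definition block_rest (l : nat) : nat := (2 ^ (block l).+1 - 1 - l)%N.

Lemma block_ltn l : (l < 2 ^ (block l).+1)%N.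
Proof. exact: trunc_log_ltn. Qed.

Lemma block_mono l m : (l <= m)%N -> (block l <= block m)%N.
Proof. exact: leq_trunc_log. Qed.

Lemma block_restS l : block l.+1 == block l -> block_rest l = (block_rest l.+1).+1.
Proof.
move=> /eqP bl; have := block_ltn l.+1; rewrite /block_rest bl; lia.
Qed.

Lemma block_rest_ltn l : (0 < l)%N -> (block_rest l < 2 ^ l)%N.
Proof.
case: l => [//|l] _; have := @trunc_logP 2 l.+1 isT isT.
have : (l.+1 < 2 ^ l.+1)%N by exact: ltn_expl.
rewrite /block_rest -/(block _) [(2 ^ (block l.+1).+1)%N]expnS.
move: (2 ^ block l.+1)%N (2 ^ l.+1)%N => a b; lia.
Qed.

Lemma block_eq j i : (2 ^ j <= i < 2 ^ j.+1)%N -> block i = j.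
Proof. exact: trunc_log_eq. Qed.

(** A proportion of the levels from [l + 1] to [n] consists of consecutive
    levels of one block: the last block, or the one before. *)
Lemma block_interval l n : (l < n)%N -> exists m k,
  [/\ (l < m)%N, (m + k <= n.+1)%N, (n - l <= 4 * k)%N &
      forall i, (m <= i < m + k)%N -> block i = block m].
Proof.
move=> ln; have n0 : (0 < n)%N by apply: leq_ltn_trans ln.
have /= := @trunc_logP 2 n isT n0; have := block_ltn n; rewrite -/(block n).
have same m k j : (0 < k)%N -> (2 ^ j <= m)%N -> (m + k <= 2 ^ j.+1)%N ->
    forall i, (m <= i < m + k)%N -> block i = block m.
  move=> k0 jm mj i /andP[mi im]; rewrite !(@block_eq j)//.
    by apply/andP; split => //; lia.
  by apply/andP; split => //; lia.
case bn : (block n) => [|J].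
  rewrite expn1 expn0 => n2 _; have n1 : n = 1%N by lia.
  by exists 1%N, 1%N; split; [lia|lia|lia|exact: (same _ _ 0%N)].
move=> lt le; rewrite !expnS in lt le.
have := expn_gt0 2 J; rewrite /= => P0.
have P1 : (2 ^ J.+1 = 2 * 2 ^ J)%N by rewrite expnS.
have P2 : (2 ^ J.+2 = 2 * (2 * 2 ^ J))%N by rewrite !expnS.
have [lJ1|lJ1] := leqP (2 * 2 ^ J) l.+1.
  exists l.+1, (n - l)%N; split; [lia|lia|lia|].
  by apply: (same _ _ J.+1); lia.
have [big|small] := leqP (n - l) (2 * (n.+1 - 2 * 2 ^ J)).
  exists (2 * 2 ^ J)%N, (n.+1 - 2 * 2 ^ J)%N; split; [lia|lia|lia|].
  by apply: (same _ _ J.+1); lia.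
have [lJ|lJ] := leqP (2 ^ J) l.
  exists l.+1, (2 * 2 ^ J - l.+1)%N; split; [lia|lia|lia|].
  by apply: (same _ _ J); lia.
exists (2 ^ J)%N, (2 ^ J)%N; split; [lia|lia|lia|].
by apply: (same _ _ J); lia.
Qed.

(** * The construction along an enumeration of the tree *)

(** Choice of a sequence, each term depending on the list of the previous ones. *)
Lemma history_choice (T : Type) (x0 : T) (Q : seq T -> T -> Prop) :
  (forall s, (forall m, (m < size s)%N -> Q (take m s) (nth x0 s m)) ->
     exists d, Q s d) ->
  exists u : nat -> T, forall n, Q (mkseq u n) (u n).
Proof.
move=> step.
pose P s d := (forall m, (m < size s)%N -> Q (take m s) (nth x0 s m)) -> Q s d.
have [|F FP] := @choice _ _ P.
  move=> s; have [prev|no] := pselect (forall m, (m < size s)%N ->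
    Q (take m s) (nth x0 s m)); last by exists x0 => /no.
  by have [d Qd] := step s prev; exists d.
pose hist n := iter n (fun s => rcons s (F s)) [::].
have histE n : hist n = mkseq (F \o hist) n.
  by elim: n => // n IH; rewrite /hist iterS -/(hist n) mkseqS {1}IH.
exists (F \o hist); elim/ltn_ind => n IH; rewrite -histE /=; apply: FP => m.
rewrite histE size_mkseq => mn; rewrite nth_mkseq//.
have -> : take m (mkseq (F \o hist) n) = mkseq (F \o hist) m.
  by rewrite /mkseq -map_take take_iota (minn_idPl (ltnW mn)).
exact: IH.
Qed.

Section Construction.
Context {R : realType} (X : normedModType R).

(** The precision of the approximations made at the node [n]. The factor [1 / 32]
    keeps the sum of the errors that accumulate along a branch below [1 / 32], see
    [sum_block_error]. *)
Definition error (n : nat) : R := 1 / 32 * (1 / 4) ^+ n.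

Lemma error_gt0 n : 0 < error n.
Proof. by rewrite mulr_gt0// ?exprn_gt0//; lra. Qed.

Lemma error_le m n : (m <= n)%N -> error n <= error m.
Proof.
by move=> mn; rewrite ler_pM2l ?ler_wiXn2l//; lra.
Qed.

(** A node carries a point [pt] of the bidual, a functional [fn] that detects
    it, and a vector [vec] of the space that approximates [pt]. *)
Record node := Node { pt : dual (dual X) ; fn : dual X ; vec : X }.

Definition root : node := Node 0 0 0.

(** The tree is given on the natural numbers by the predecessor map [par] and
    the level [lev]; the point of a node is a small perturbation, in the weak*
    sense, of the point [base] of its predecessor, except that every block of
    levels starts afresh from [0]. *)
Context (par lev : nat -> nat).

Definition base (u : nat -> node) (n : nat) : dual (dual X) :=
  if block (lev n) == block (lev (par n)) then pt (u (par n)) else 0.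

(** The relations between the node [n] and the previous nodes: [fn (u n)] detects
    the increment of [pt] at [n] and almost vanishes on everything chosen before,
    while the new point hardly moves with respect to the previous functionals,
    and the new vector hardly differs from the new point with respect to all of
    them. *)
Definition admissible (u : nat -> node) (n : nat) : Prop :=
  [/\ `|vec (u n)| <= 1, `|fn (u n)| <= 12,
      (0 < n)%N -> 1 / 2 <= dual_fun (pt (u n) - base u n) (fn (u n)),
      `|dual_fun (fn (u n)) (vec (u n)) - dual_fun (pt (u n)) (fn (u n))| <= error n &
      forall m, (m < n)%N ->
       [/\ `|dual_fun (fn (u n)) (vec (u m))| <= error n,
           `|dual_fun (pt (u m)) (fn (u n))| <= error n,
           `|dual_fun (pt (u n) - base u n) (fn (u m))| <= error n &
           `|dual_fun (fn (u m)) (vec (u n)) - dual_fun (pt (u n)) (fn (u m))|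
              <= error n]].

Hypothesis derived0 : forall n, iter n (wder (1 / 4)) (@dual_ball R (dual X)) 0.
Hypothesis par0 : par 0 = 0%N.
Hypothesis lev0 : lev 0 = 0%N.
Hypothesis par_ltn : forall n, (0 < n)%N -> (par n < n)%N.
Hypothesis levE : forall n, (0 < n)%N -> lev n = (lev (par n)).+1.

(** The points are chosen in successive derived sets, the node [n] leaving enough
    derivations for the remaining levels of its block. *)
Lemma exists_admissible : exists u, u 0%N = root /\ forall n, admissible u n.
Proof.
pose Q (s : seq node) (d : node) := let n := size s in
  let u := nth root (rcons s d) in
  [/\ n = 0%N -> d = root,
      iter (block_rest (lev n)) (wder (1 / 4)) (@dual_ball R (dual X)) (pt d) &
      admissible u n].
have [s prev|u uP] := @history_choice node root Q; last first.
  exists u; split; first by have [-> //] := uP 0%N.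
  move=> n; have [_ _] := uP n; rewrite size_mkseq.
  have uE m : (m <= n)%N -> nth root (rcons (mkseq u n) (u n)) m = u m.
    by move=> mn; rewrite -mkseqS nth_mkseq.
  have par_le : (par n <= n)%N.
    by case: (posnP n) => [->|n0]; [rewrite par0|rewrite ltnW// par_ltn].
  have bE : base (nth root (rcons (mkseq u n) (u n))) n = base u n.
    by rewrite /base uE.
  rewrite /admissible bE !uE// => -[vn gn sep diag old]; split => // m mn.
  by have := old m mn; rewrite uE// ltnW.
have nthE d m : (m < size s)%N -> nth root (rcons s d) m = nth root s m.
  by move=> ms; rewrite nth_rcons ms.
have nthn d : nth root (rcons s d) (size s) = d by rewrite nth_rcons ltnn eqxx.
have [s0|s0] := posnP (size s).
  exists root; rewrite /Q /admissible nthn s0 lev0; split => //.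
  split => //=; rewrite ?normr0//.
    by rewrite (_ : _ - _ = 0) ?normr0 ?ltW ?error_gt0//; exact: (@subrr R 0).
pose b := base (nth root s) (size s).
have bE d : base (nth root (rcons s d)) (size s) = b.
  by rewrite /base nthE// par_ltn.
have db : wder (1 / 4)
    (iter (block_rest (lev (size s))) (wder (1 / 4)) (@dual_ball R (dual X))) b.
  rewrite -iterS /b /base; case: ifP => [bl|_]; last exact: derived0.
  rewrite levE// in bl *; rewrite -block_restS//.
  by have [_] := prev _ (par_ltn s0); rewrite size_takel// ltnW// par_ltn.
pose E := [seq pt p | p <- s] ++ [seq bidual (vec p) | p <- s].
have err := error_gt0 (size s).
have q0 : (0 : R) < 1 / 4 by lra.
have [y [g [yK g3 sep Eg Gy]]] := wder_separation E [seq fn p | p <- s] q0 err db.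
have y1 : `|y| <= 1 by exact: iter_wder_sub yK.
have [x x1 xG] := goldstine (g :: [seq fn p | p <- s]) y1 err.
exists (Node y g x); rewrite /Q /admissible nthn bE; split => [s00||].
- by rewrite s00 in s0.
- exact: yK.
split => //=.
- by apply: le_trans g3 _; rewrite le_eqVlt; apply/orP; left; apply/eqP; field.
- move=> _; apply: le_trans sep; have := @error_le 0 (size s) isT.
  by rewrite /error expr0; lra.
- by apply: xG; rewrite mem_head.
move=> m ms; rewrite nthE//.
have mem_f (S : eqType) (f : node -> S) : f (nth root s m) \in map f s.
  by rewrite -(nth_map root (f root))// mem_nth// size_map.
split.
- apply: (Eg (bidual (vec (nth root s m)))); rewrite mem_cat.
  by rewrite [X in _ || X](mem_f _ (fun p => bidual (vec p))) orbT.
- by apply: Eg; rewrite mem_cat mem_f.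
- by apply: Gy; exact: mem_f.
- by apply: xG; rewrite inE mem_f orbT.
Qed.

End Construction.
(** * Evaluating along a branch *)

Section Branch.
Context {R : realType} (X : normedModType R) (par lev : nat -> nat).
Context (u : nat -> node X).
Hypothesis par_ltn : forall n, (0 < n)%N -> (par n < n)%N.
Hypothesis levE : forall n, (0 < n)%N -> lev n = (lev (par n)).+1.
Hypothesis lev0 : lev 0 = 0%N.
Hypothesis u0 : u 0%N = root X.
Hypothesis u_adm : forall n, admissible par lev u n.

(** The sum of the errors of the levels of the block of [i], up to [i]. *)
Fixpoint block_error (i : nat) : R :=
  if i is i'.+1 then
    error i + (if block i == block i' then block_error i' else 0)
  else 0.

Lemma block_error_ge0 i : 0 <= block_error i.
Proof.
by elim: i => //= i IH; rewrite addr_ge0 ?(ltW (error_gt0 _))//; case: ifP.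
Qed.

Lemma error_le_block i : (0 < i)%N -> error i <= block_error i :> R.
Proof.
by case: i => //= i _; rewrite lerDl; case: ifP => // _; exact: block_error_ge0.
Qed.

Lemma sum_block_error n : \sum_(i < n) block_error i.+1 <= 1 / 32.
Proof.
(* The second term accounts for the part of the current error that the
   remaining levels of the block will inherit. *)
suff : \sum_(i < n) block_error i.+1 + (block_rest n)%:R * block_error n <=
    1 / 32 * (1 - (1 / 2) ^+ n).
  have : 0 <= (block_rest n)%:R * block_error n by rewrite mulr_ge0 ?block_error_ge0.
  have : (0 : R) <= (1 / 2) ^+ n by rewrite exprn_ge0//; lra.
  lra.
elim: n => [|n IH]; first by rewrite big_ord0 mulr0 expr0; lra.
have step : (block_rest n.+1).+1%:R * error n.+1 <= 1 / 32 * (1 / 2) ^+ n.+1 :> R.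
  rewrite /error mulrCA ler_pM2l; last by lra.
  have -> : (1 / 4 : R) = 1 / 2 * (1 / 2) by lra.
  rewrite exprMn mulrA ler_piMl//.
  rewrite expr_div_n expr1n mulrC mul1r ler_pdivrMl ?exprn_gt0// mulr1.
  by rewrite -natrX ler_nat block_rest_ltn.
have := block_error_ge0 n; rewrite big_ord_recr /=.
case: ifP => [/block_restS bl|_] e0.
  rewrite bl -natr1 in IH; rewrite -natr1 in step; rewrite exprS in step *.
  nra.
have : 0 <= (block_rest n)%:R * block_error n by rewrite mulr_ge0.
rewrite -natr1 in step; rewrite exprS in step *; nra.
Qed.

(** A branch of length [N] of the tree, given by its nodes from the root. *)
Context (N : nat) (W : nat -> nat).
Hypothesis W0 : W 0 = 0%N.
Hypothesis W_gt0 : forall i, (i < N)%N -> (0 < W i.+1)%N.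
Hypothesis parW : forall i, (i < N)%N -> par (W i.+1) = W i.

Lemma levW i : (i <= N)%N -> lev (W i) = i.
Proof.
elim: i => [|i IH] iN; first by rewrite W0.
by rewrite levE ?W_gt0// parW// IH// ltnW.
Qed.

Lemma leqW i j : (j <= i)%N -> (i <= N)%N -> (W j <= W i)%N.
Proof.
move=> /subnKC <-; elim: (i - j)%N => [|k IH]; first by rewrite addn0.
rewrite addnS => kN; apply: (leq_trans (IH (ltnW kN))).
by rewrite -{1}(parW kN) ltnW// par_ltn// W_gt0.
Qed.

Lemma leq_idW i : (i <= N)%N -> (i <= W i)%N.
Proof.
elim: i => [|i IH] iN //; apply: (leq_ltn_trans (IH (ltnW iN))).
by rewrite -{1}(parW iN) par_ltn// W_gt0.
Qed.

(** The branch goes through [v], and [i] is a level of the block of [lev v] that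
    is at least [lev v]. *)
Definition hit (v i : nat) : bool :=
  [&& (lev v <= i)%N, W (lev v) == v & block (lev v) == block i].

Lemma hitS v i : (i < N)%N -> W i.+1 <> v ->
  hit v i.+1 = (block i.+1 == block i) && hit v i.
Proof.
move=> iN Wv; rewrite /hit.
have [lt|gt|eq] := ltngtP (lev v) i.+1; last 2 first.
- by rewrite (leqNgt _ i) (ltnW gt) /= andbF.
- have /negbTE -> : W (lev v) != v by apply/eqP; rewrite eq.
  by rewrite /= !andbF.
rewrite ltnS in lt; rewrite lt /=; case: (W (lev v) == v) => /=; last by rewrite andbF.
apply/eqP/andP => [bl|[/eqP -> /eqP]//].
have := block_mono lt; have := block_mono (leqnSn i); rewrite bl => h1 h2.
by split; rewrite eqn_leq h1 h2.
Qed.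

(** The functional of [v] takes values about [1 / 2] or more at the points of the
    descendants of [v] in its block, and almost vanishes at all the other ones. *)
Lemma pt_branch v i : (0 < v)%N -> (i <= N)%N ->
  if hit v i then 1 / 2 - block_error i <= dual_fun (pt (u (W i))) (fn (u v))
  else `|dual_fun (pt (u (W i))) (fn (u v))| <= block_error i.
Proof.
move=> v0; elim: i => [_|i IH iN].
  have -> : hit v 0 = false by rewrite /hit leqn0 levE.
  by rewrite W0 u0 /= normr0.
have {}IH := IH (ltnW iN).
have w0 := W_gt0 iN; have lw := levW iN; have lp := levW (ltnW iN).
have baseE : base par lev u (W i.+1) =
    if block i.+1 == block i then pt (u (W i)) else 0.
  by rewrite /base (parW iN) lw lp.
have err_w : error (W i.+1) <= error i.+1 :> R by apply: error_le; exact: leq_idW.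
have e0 := block_error_ge0 i; have err0 := @error_gt0 R i.+1.
have [wv|vw|wv] := ltngtP (W i.+1) v.
- have -> : hit v i.+1 = false.
    apply/negP => /and3P[lv /eqP Wv _].
    by have := leqW lv iN; rewrite Wv leqNgt wv.
  have [_ _ _ _ /(_ _ wv)[_ le _ _]] := u_adm v.
  apply: le_trans le _; apply: le_trans (error_le_block _) => //.
  by apply: le_trans err_w; exact: error_le (ltnW wv).
- have Wv : W i.+1 <> v by move=> wv; rewrite wv ltnn in vw.
  rewrite hitS//; have [_ _ _ _ /(_ _ vw)[_ _ + _]] := u_adm (W i.+1).
  rewrite baseE dual_funB /=; case: ifP => [_ le|_ le] /=; last first.
    rewrite addr0; apply: le_trans err_w; apply: le_trans le.
    by rewrite (_ : dual_fun 0 _ = 0)// subr0.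
  move: le; rewrite ler_norml => /andP[le1 le2]; move: IH; case: ifP => _.
    by lra.
  by rewrite !ler_norml => /andP[h1 h2]; apply/andP; split; lra.
- have -> : hit v i.+1 by rewrite /hit -wv lw leqnn !eqxx.
  have := u_adm (W i.+1) => -[_ _ /(_ w0) + _ _].
  rewrite wv in baseE *; rewrite baseE dual_funB /=; case: ifP => _.
    move: IH; have -> : hit v i = false by rewrite /hit -wv lw ltnn.
    rewrite ler_norml => /andP[h1 h2] h; lra.
  rewrite (_ : dual_fun 0 _ = 0)//; lra.
Qed.

Lemma vec_branch v i : (0 < v)%N -> (0 < i)%N -> (i <= N)%N ->
  if hit v i then 1 / 2 - 2 * block_error i <= dual_fun (fn (u v)) (vec (u (W i)))
  else `|dual_fun (fn (u v)) (vec (u (W i)))| <= 2 * block_error i.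
Proof.
move=> v0 i0 iN; have := pt_branch v0 iN.
have err_w : error (W i) <= block_error i :> R.
  by apply: le_trans (error_le_block i0); apply: error_le; exact: leq_idW.
have e0 := block_error_ge0 i.
have [wv|vw] := ltnP (W i) v.
  have -> : hit v i = false.
    apply/negP => /and3P[lv /eqP Wv _].
    by have := leqW lv iN; rewrite Wv leqNgt wv.
  move=> _; have [_ _ _ _ /(_ _ wv)[le _ _ _]] := u_adm v.
  by have := @error_le R _ _ (ltnW wv); lra.
have : `|dual_fun (fn (u v)) (vec (u (W i))) - dual_fun (pt (u (W i))) (fn (u v))|
    <= error (W i).
  move: vw; rewrite leq_eqVlt => /orP[/eqP ->|vw].
    by have [_ _ _] := u_adm (W i).
  by have [_ _ _ _ /(_ _ vw)[]] := u_adm (W i).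
rewrite ler_norml => /andP[h1 h2]; case: ifP => _; first lra.
by rewrite !ler_norml => /andP[h3 h4]; apply/andP; split; lra.
Qed.

(** The sum of the vectors of the nodes of the branch, except the root. *)
Definition branch_sum : X := \sum_(i < N) vec (u (W i.+1)).

Lemma fn_branch_sum_ge v : (0 < v)%N ->
  1 / 2 * (\sum_(i < N) hit v i.+1)%:R - 1 / 16 <= dual_fun (fn (u v)) branch_sum.
Proof.
move=> v0; rewrite dual_fun_sumr natr_sum mulr_sumr.
have := sum_block_error N => le.
apply: (@le_trans _ _ (\sum_(i < N) (1 / 2 * (hit v i.+1)%:R - 2 * block_error i.+1))).
  by rewrite sumrB -!mulr_sumr; lra.
apply: ler_sum => i _; have := @vec_branch v i.+1 v0 isT (ltn_ord i).
case: ifP => _ /=; first by lra.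
by rewrite ler_norml => /andP[]; lra.
Qed.

Lemma fn_branch_sum_le v : (0 < v)%N -> (forall i, (i <= N)%N -> W i <> v) ->
  `|dual_fun (fn (u v)) branch_sum| <= 1 / 16.
Proof.
move=> v0 Wv; rewrite dual_fun_sumr.
apply: le_trans (ler_norm_sum _ _ _) _.
apply: (@le_trans _ _ (\sum_(i < N) 2 * block_error i.+1)); last first.
  by rewrite -mulr_sumr; have := sum_block_error N; lra.
apply: ler_sum => i _; have := @vec_branch v i.+1 v0 isT (ltn_ord i).
rewrite (_ : hit v i.+1 = false)//; apply/negP => /and3P[lv /eqP Wlv _].
by apply: Wv Wlv; exact: leq_trans lv (ltn_ord i).
Qed.

End Branch.

(** * The tree of finite sequences *)

(** An enumeration of the tree in which each sequence comes after its initial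
    segments. The sequence [rcons s a] has code [2 ^ p * (2 * a + 1)], where [p] is the code
    of [s], so that the predecessor of [n] in the tree is [logn 2 n]. *)
Definition tree_code : tree -> nat :=
  foldl (fun p (a : {n : nat | (0 < n)%N}) => (2 ^ p * (2 * val a + 1))%N) 0%N.

Lemma tree_code_rcons s a :
  tree_code (rcons s a) = (2 ^ tree_code s * (2 * val a + 1))%N.
Proof. by rewrite /tree_code -cats1 foldl_cat. Qed.

Lemma tree_code_rcons_gt0 s a : (0 < tree_code (rcons s a))%N.
Proof. by rewrite tree_code_rcons muln_gt0 expn_gt0 addn1. Qed.

Lemma logn_tree_code s a : logn 2 (tree_code (rcons s a)) = tree_code s.
Proof.
rewrite tree_code_rcons lognM ?expn_gt0 ?addn1// pfactorK//.
by rewrite lognE /= dvdn2 /= mul2n odd_double /= addn0.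
Qed.

Lemma tree_code_inj : injective tree_code.
Proof.
elim/last_ind => [t|s a IH t]; case/lastP: t => [|t b] // eq_code.
- by have := tree_code_rcons_gt0 t b; rewrite -eq_code.
- by have := tree_code_rcons_gt0 s a; rewrite eq_code.
have st : s = t by apply: IH; rewrite -(logn_tree_code s a) eq_code logn_tree_code.
move: eq_code; rewrite !tree_code_rcons st => /eqP.
rewrite eqn_pmul2l ?expn_gt0// eqn_add2r eqn_pmul2l// => /eqP ab.
by rewrite (val_inj ab).
Qed.

Lemma logn2_ltn n : (0 < n)%N -> (logn 2 n < n)%N.
Proof.
move=> n0; apply: (leq_trans (ltn_expl _ (leqnn 2))).
by rewrite dvdn_leq// pfactor_dvdnn.
Qed.

Lemma exists_level (par : nat -> nat) : (forall n, (0 < n)%N -> (par n < n)%N) ->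
  exists lev : nat -> nat, lev 0%N = 0%N /\
    forall n, (0 < n)%N -> lev n = (lev (par n)).+1.
Proof.
move=> par_ltn.
pose Q (s : seq nat) d := d = if size s is 0 then 0%N else (nth 0%N s (par (size s))).+1.
have [s _|lev levP] := @history_choice nat 0%N Q; first by eexists.
exists lev; split; first exact: (levP 0%N).
move=> n n0; rewrite [LHS]levP size_mkseq; case: n n0 => // n n0.
by rewrite nth_mkseq// par_ltn.
Qed.

Section GreatestCommonAncestor.
Implicit Types s t : tree.

Lemma size_gca s t : (size (greatest_common_ancestor s t) <= size s)%N.
Proof. by elim: s t => [|x s IH] [|y t] //=; case: eqP => //= _; exact: IH. Qed.

Lemma gcaC s t : greatest_common_ancestor s t = greatest_common_ancestor t s.
Proof.
elim: s t => [|x s IH] [|y t] //=; rewrite eq_sym; case: eqP => // ->.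
by rewrite IH.
Qed.

Lemma take_gca s t i : (i <= size (greatest_common_ancestor s t))%N ->
  take i s = take i t.
Proof.
elim: s t i => [|x s IH] [|y t] [|i] //=; case: eqP => //= -> /IH.
by move=> ->.
Qed.

Lemma gca_take s t i : (i <= size s)%N -> (i <= size t)%N -> take i s = take i t ->
  (i <= size (greatest_common_ancestor s t))%N.
Proof.
elim: s t i => [|x s IH] [|y t] [|i] //= si ti [-> st]; rewrite eqxx /=.
exact: IH.
Qed.

Lemma tree_dist_gt0 (R : realType) s t : s <> t -> 0 < tree_dist R s t.
Proof.
move=> st; rewrite /tree_dist.
set l := size (greatest_common_ancestor s t).
have ls : (l <= size s)%N by exact: size_gca.
have lt : (l <= size t)%N by rewrite /l gcaC; exact: size_gca.
have : (2 * l < size s + size t)%N.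
  rewrite ltnNge; apply/negP => le; apply: st.
  have sl : size s = l by lia.
  have tl : size t = l by lia.
  have := @take_gca s t l (leqnn _).
  by rewrite -{1}sl -tl !take_size.
by rewrite -(ltr_nat R) natrD natrM; lra.
Qed.

End GreatestCommonAncestor.

(** * The embedding *)

Section TreeSum.
Context {R : realType} (X : normedModType R).

(** The codes of the ancestors of [s]. *)
Definition tree_branch (s : tree) (i : nat) : nat := tree_code (take i s).

Lemma tree_branch_neq s t m j : (size (greatest_common_ancestor s t) < m)%N ->
  (m <= size s)%N -> (j <= size t)%N -> tree_branch t j <> tree_branch s m.
Proof.
move=> um ms jt /tree_code_inj eq_take.
have jm : j = m by rewrite -(size_takel jt) eq_take size_takel.
rewrite jm in jt eq_take; have := gca_take ms jt (esym eq_take).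
by rewrite leqNgt um.
Qed.

Lemma tree_branch_gt0 s i : (i < size s)%N -> (0 < tree_branch s i.+1)%N.
Proof.
case: s => // x0 s' si; rewrite /tree_branch (take_nth x0)//.
exact: tree_code_rcons_gt0.
Qed.

Lemma logn_tree_branch s i : (i < size s)%N ->
  logn 2 (tree_branch s i.+1) = tree_branch s i.
Proof.
case: s => // x0 s' si; rewrite /tree_branch (take_nth x0)//.
exact: logn_tree_code.
Qed.

Context (u : nat -> node X).
Hypothesis u0 : u 0%N = root X.
Context (lev : nat -> nat).
Hypothesis lev0 : lev 0 = 0%N.
Hypothesis levE : forall n, (0 < n)%N -> lev n = (lev (logn 2 n)).+1.
Hypothesis u_adm : forall n, admissible (logn 2) lev u n.

(** The embedding: the sum of the vectors of the ancestors of [s], except the root. *)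
Definition tree_sum (s : tree) : X := branch_sum u (size s) (tree_branch s).

Lemma norm_tree_sumB_le s t : `|tree_sum s - tree_sum t| <= tree_dist R s t.
Proof.
set l := size (greatest_common_ancestor s t).
have ls : (l <= size s)%N by exact: size_gca.
have lt : (l <= size t)%N by rewrite /l gcaC; exact: size_gca.
pose F r i := vec (u (tree_branch r i.+1)).
have split_sum r : (l <= size r)%N -> tree_sum r =
    \sum_(0 <= i < l) F r i + \sum_(l <= i < size r) F r i.
  by move=> lr; rewrite -big_cat_nat//= big_mkord.
have tail_le r : (l <= size r)%N ->
    `|\sum_(l <= i < size r) F r i| <= (size r)%:R - l%:R.
  move=> lr; apply: le_trans (ler_norm_sum _ _ _) _.
  apply: (@le_trans _ _ (\sum_(l <= i < size r) 1)).
    by apply: ler_sum => i _; have [] := u_adm (tree_branch r i.+1).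
  by rewrite sumr_const_nat natrB.
rewrite !split_sum//.
have -> : \sum_(0 <= i < l) F s i = \sum_(0 <= i < l) F t i.
  apply: eq_big_nat => i il.
  by rewrite /F /tree_branch (@take_gca s t).
rewrite opprD addrACA subrr add0r; apply: le_trans (ler_normB _ _) _.
apply: le_trans (lerD (tail_le s ls) (tail_le t lt)) _.
by rewrite /tree_dist -/l; lra.
Qed.

(** Among the ancestors of [s] that are not ancestors of [t], there is one, [v],
    such that at least a quarter of them are [v] or its descendants in its block;
    the functional of [v] gives the lower bound. *)
Lemma norm_tree_sumB_ge_one_side s t :
  ((size s)%:R - (size (greatest_common_ancestor s t))%:R) / 128 <=
    `|tree_sum s - tree_sum t|.
Proof.
set l := size (greatest_common_ancestor s t).
have ls : (l <= size s)%N by exact: size_gca.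
have [sl|ls'] := leqP (size s) l.
  apply: le_trans (normr_ge0 _).
  by rewrite ler_pdivrMr// mul0r subr_le0 ler_nat.
have [m [k [lm mk lk blm]]] := block_interval ls'.
have k0 : (0 < k)%N by lia.
have ms : (m <= size s)%N by lia.
pose v := tree_branch s m.
have v0 : (0 < v)%N.
  rewrite /v; case: (m) lm ms => // m' _; exact: tree_branch_gt0.
have par_ltn := logn2_ltn.
have W0 r : tree_branch r 0 = 0%N by rewrite /tree_branch take0.
have lv : lev v = m.
  by apply: (levW levE lev0 (W0 s)) ms; [exact: tree_branch_gt0|exact: logn_tree_branch].
have lo := fn_branch_sum_ge par_ltn levE lev0 u0 u_adm (W0 s) (@tree_branch_gt0 s)
  (@logn_tree_branch s) v0.
have up := fn_branch_sum_le par_ltn levE lev0 u0 u_adm (W0 t) (@tree_branch_gt0 t)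
  (@logn_tree_branch t) v0 (fun j jt => tree_branch_neq lm ms jt).
rewrite -/(tree_sum _) in lo up.
have hits : (k <= \sum_(i < size s) hit lev (tree_branch s) v i.+1)%N.
  rewrite -(big_mkord xpredT (fun i => nat_of_bool (hit lev (tree_branch s) v i.+1))).
  rewrite (@big_cat_nat _ _ _ m.-1)/=; [|lia|lia].
  rewrite (@big_cat_nat _ _ _ (m.-1 + k) m.-1)/=; [|lia|lia].
  rewrite addnCA; apply: leq_trans (leq_addr _ _).
  rewrite -[leqLHS](addKn m.-1) -[leqLHS]muln1 -sum_nat_const_nat.
  rewrite !big_nat; apply: leq_sum => i /andP[mi ik].
  rewrite /hit lv eqxx /= (blm i.+1) ?eqxx ?andbT; last lia.
  by rewrite (_ : (m <= i.+1)%N)//; lia.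
have := dual_fun_le (fn (u v)) (tree_sum s - tree_sum t).
rewrite dual_funBr.
set fs := dual_fun _ (tree_sum s) in lo *; set ft := dual_fun _ (tree_sum t) in up *.
move=> /(le_trans (ler_norm _)) le_fn.
have [_ fn12 _ _ _] := u_adm v.
have : `|fn (u v)| * `|tree_sum s - tree_sum t| <= 12 * `|tree_sum s - tree_sum t|.
  by rewrite ler_wpM2r.
have kR : k%:R <= (\sum_(i < size s) hit lev (tree_branch s) v i.+1)%:R :> R.
  by rewrite ler_nat.
have k1 : 1 <= k%:R :> R by rewrite ler1n.
have lkR : (size s)%:R - l%:R <= 4 * k%:R :> R.
  by rewrite -natrB// -natrM ler_nat.
by move: up; rewrite ler_norml => /andP[up1 up2]; lra.
Qed.

Lemma norm_tree_sumB_ge s t : tree_dist R s t / 256 <= `|tree_sum s - tree_sum t|.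
Proof.
have := norm_tree_sumB_ge_one_side s t; have := norm_tree_sumB_ge_one_side t s.
by rewrite distrC gcaC /tree_dist; lra.
Qed.

End TreeSum.

Lemma embeds_with_bilipschitz {R : realType} (M N : Type) (d : M -> M -> R)
    (delta : N -> N -> R) (f : M -> N) (C : R) (x0 y0 : M) : 0 < C -> x0 <> y0 ->
  (forall x y, x <> y -> 0 < d x y) ->
  (forall x y, x <> y -> d x y / C <= delta (f x) (f y) <= d x y) ->
  (forall x, delta (f x) (f x) <= 0) ->
  embeds_with d delta C.
Proof.
move=> C0 xy0 dpos lip delta0.
have delta_gt0 x y : x <> y -> 0 < delta (f x) (f y).
  move=> xy; have /andP[+ _] := lip x y xy; apply: lt_le_trans.
  by rewrite divr_gt0// dpos.
exists f => [x y fxy|].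
  apply: contrapT => xy; have := delta_gt0 x y xy.
  by rewrite fxy ltNge delta0.
rewrite /distortion -[leRHS]mul1e; apply: lee_pmul.
- apply: (le_trans _ (ereal_sup_ubound _)); last by exists (x0, y0).
  by rewrite lee_fin divr_ge0// ltW// ?dpos// delta_gt0.
- apply: (le_trans _ (ereal_sup_ubound _)); last by exists (x0, y0).
  by rewrite lee_fin divr_ge0// ltW// ?dpos// delta_gt0.
- apply: ge_ereal_sup => _ [[x y] /= xy <-]; rewrite lee_fin.
  by rewrite ler_pdivrMr ?dpos// mul1r; have /andP[] := lip x y xy.
- apply: ge_ereal_sup => _ [[x y] /= xy <-]; rewrite lee_fin.
  rewrite ler_pdivrMr ?delta_gt0// -ler_pdivrMl// mulrC.
  by have /andP[] := lip x y xy.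
Qed.

Theorem theorem2p6 (R : realType) :
  exists C : R, 1 <= C /\
    forall X : completeNormedModType R,
      separable X ->
      xlt (Some omega) (szlenk (dual X)) ->
      embeds_with (tree_dist R) (@norm_dist R X) C.
Proof.
exists 256; split; first lra.
move=> X _ /szlenk_gt_omega_wder derived0.
have [lev [lev0 levE]] := exists_level logn2_ltn.
have [u [u0 u_adm]] := exists_admissible derived0 (logn0 2) lev0 logn2_ltn levE.
have one_gt0 : (0 < 1)%N by [].
apply: (@embeds_with_bilipschitz _ _ _ _ _ (tree_sum u) _ [::] [:: exist _ 1%N one_gt0]).
- by [].
- by [].
- exact: tree_dist_gt0.
- move=> s t _; rewrite /norm_dist (norm_tree_sumB_ge u0 lev0 levE u_adm).
  exact: norm_tree_sumB_le u_adm _ _.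
- by move=> s; rewrite /norm_dist subrr normr0.
Qed.
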